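(* Let $K:\mathbb{R}^d\to\mathbb{R}$ be a continuous positive definite kernel with native space $\mathcal{H}_K$, let $\mathbb{X}=\{x^1,\dots,x^{n}\}\subset\mathbb{R}^d$ be a set of $n=|\mathbb{X}|<\infty$ distinct points and let $\mathbb{Y}=(y^1,\dots,y^n)\in\mathbb{R}^n$. For $\alpha>0$ let $u^\alpha_{\mathbb{X},\mathbb{Y}}\in\mathcal{H}_K$ be the unique minimizer over $\mathcal{H}_K$ of $$E_\alpha(u)=\frac12\Big\{\|u\|_{\mathcal{H}_K}^2+\frac1\alpha|u(\mathbb{X})-\mathbb{Y}|^2\Big\},$$ and let $u^0_{\mathbb{X},\mathbb{Y}}$ be the unique minimizer of $E_0(u)=\frac12\|u\|_{\mathcal{H}_K}^2$ over $\{u\in\mathcal{H}_K : u(\mathbb{X})=\mathbb{Y}\}$. Denote the corresponding minima by $e_\alpha=E_\alpha(u^\alpha_{\mathbb{X},\mathbb{Y}})$, $\alpha\ge 0$, and let $0<\alpha_0<\alpha_1$. Then: (i) $u^\alpha_{\mathbb{X},\mathbb{Y}}\to u^0_{\mathbb{X},\mathbb{Y}}$ in $\mathcal{H}_K$ as $\alpha\searrow 0$. (ii) $0\le e_{\alpha_1}\le e_{\alpha_0}\le\frac12\|u^0_{\mathbb{X},\mathbb{Y}}\|_{\mathcal{H}_K}^2$ and $|u^{\alpha_0}_{\mathbb{X},\mathbb{Y}}(\mathbb{X})-\mathbb{Y}|^2\le|u^{\alpha_1}_{\mathbb{X},\mathbb{Y}}(\mathbb{X})-\mathbb{Y}|^2$.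 (iii) $\|u^{\alpha_1}_{\mathbb{X},\mathbb{Y}}\|_{\mathcal{H}_K}\le\|u^{\alpha_0}_{\mathbb{X},\mathbb{Y}}\|_{\mathcal{H}_K}\le\|u^0_{\mathbb{X},\mathbb{Y}}\|_{\mathcal{H}_K}$. (iv) $|u^\alpha_{\mathbb{X},\mathbb{Y}}(\mathbb{X})-\mathbb{Y}|^2\le\alpha\big[\|u^0_{\mathbb{X},\mathbb{Y}}\|_{\mathcal{H}_K}^2-\|u^\alpha_{\mathbb{X},\mathbb{Y}}\|_{\mathcal{H}_K}^2\big]$ for every $\alpha>0$.
   Context: A continuous kernel $K:\mathbb{R}^d\to\mathbb{R}$ is called positive definite if for every finite set $\mathbb{X}=\{x^1,\dots,x^n\}$ of distinct points of $\mathbb{R}^d$ the matrix $K(\mathbb{X},\mathbb{X})=[K(x^j-x^k)]_{1\le j,k\le n}$ is symmetric positive definite. The native space (reproducing kernel Hilbert space) $\mathcal{H}_K$ of $K$ is the completion of the space of finite linear combinations $\sum_k a_kK(\cdot-x^k)$ with respect to the inner product determined by $(K(\cdot-x)\,|\,K(\cdot-y))_{\mathcal{H}_K}=K(x-y)$. It is a Hilbert space of functions on $\mathbb{R}^d$ in which point evaluations $\delta_x$ are continuous linear functionals and $(u\,|\,K(\cdot-x))_{\mathcal{H}_K}=u(x)$. For a function $u$ write $u(\mathbb{X})=(u(x^1),\dots,u(x^n))\in\mathbb{R}^n$; $|\cdot|$ is the Euclidean norm on $\mathbb{R}^n$. The minimizers in the claim exist and are unique. *)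

(* Defs.v *)
From HB Require Import structures.
From mathcomp Require Import all_boot all_order all_algebra.
From mathcomp Require Import all_classical all_reals all_analysis.

Set Implicit Arguments.
Unset Strict Implicit.
Unset Printing Implicit Defensive.

Import Order.TTheory GRing.Theory Num.Theory.
Import numFieldNormedType.Exports.

Local Open Scope classical_set_scope.
Local Open Scope ring_scope.

Section Kernel.
Context {R : realType} {d : nat}.
Implicit Types (K : 'rV[R]_d -> R).

Definition kernel_matrix K n (X : 'I_n -> 'rV[R]_d) : 'M[R]_n :=
  \matrix_(j < n, k < n) K (X j - X k).

Definition sym_posdef n (M : 'M[R]_n) : Prop :=
  M^T = M /\ forall c : 'rV[R]_n, c != 0 -> 0 < (c *m M *m c^T) 0 0.

Definition positive_definite_kernel K : Prop :=
  forall n (X : 'I_n -> 'rV[R]_d), injective X -> sym_posdef (kernel_matrix K X).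

(* The completion of the span of the translates K(. - x) is determined up to
   isometry as a complete inner product space containing, as a dense subspace,
   vectors [translate x] with inner products K(x - y). The map [eval] identifies
   its elements with functions on R^d through the reproducing property. *)
Record native_space K := NativeSpace {
  native_sort :> completeNormedModType R;
  inner : {dot native_sort for idfun};
  innerE : forall u, inner u u = `|u| ^+ 2;
  translate : 'rV[R]_d -> native_sort;
  inner_translate : forall x y, inner (translate x) (translate y) = K (x - y);
  dense_translate : dense [set u | exists n (X : 'I_n -> 'rV[R]_d) (a : 'I_n -> R),
    u = \sum_(k < n) a k *: translate (X k)];
  eval : native_sort -> 'rV[R]_d -> R;
  eval_linear : forall (a : R) u v x,
    eval (a *: u + v) x = a * eval u x + eval v x;
  eval_inj : injective eval;
  eval_translate : forall x, eval (translate x) = fun y => K (y - x);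
  reproducing : forall u x, inner u (translate x) = eval u x
}.

End Kernel.

(* The library norm on 'rV[R]_n is the sup norm. *)
Definition euclidean_norm (R : realType) n (v : 'rV[R]_n) : R :=
  Num.sqrt (\sum_(k < n) v 0 k ^+ 2).

Section Regularization.
Context {R : realType} {d : nat} {K : 'rV[R]_d -> R}.
Variables (H : native_space K) (n : nat).
Variables (X : 'I_n -> 'rV[R]_d) (Y : 'rV[R]_n).
Implicit Types (alpha : R) (u : H).

Definition values u : 'rV[R]_n := \row_(k < n) eval u (X k).

Definition misfit u : R := euclidean_norm (values u - Y).

Definition energy alpha u : R :=
  if alpha == 0 then 2^-1 * `|u| ^+ 2
  else 2^-1 * (`|u| ^+ 2 + alpha^-1 * misfit u ^+ 2).

Definition admissible alpha : set H :=
  if alpha == 0 then [set u | values u = Y] else [set: H].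

Definition is_minimizer alpha u : Prop :=
  admissible alpha u /\
  forall v, admissible alpha v -> energy alpha u <= energy alpha v.

(* Takes the junk value 0 if there is no minimizer, which does not happen for
   alpha >= 0, K positive definite and X injective. *)
Definition minimizer alpha : H := xget 0 [set u | is_minimizer alpha u].

Definition min_energy alpha : R := energy alpha (minimizer alpha).

End Regularization.

(* Main.v *)
Require Import Defs.
From HB Require Import structures.
From mathcomp Require Import all_boot all_order all_algebra.
From mathcomp Require Import all_classical all_reals all_analysis.
From mathcomp Require Import ring lra.

Set Implicit Arguments.
Unset Strict Implicit.
Unset Printing Implicit Defensive.

Import Order.TTheory GRing.Theory Num.Theory.
Import numFieldNormedType.Exports.

Local Open Scope classical_set_scope.
Local Open Scope ring_scope.

(** Write [M] for the kernel matrix of the points and, for [alpha >= 0], let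
    [c_alpha] solve [c (M + alpha I) = Y]; positive definiteness makes the
    system regular. The combination [w = \sum_k c_k K(. - x^k)] satisfies
    [w(X) = c M], hence the optimality condition [w(X) + alpha c = Y]
    ([values_ridge]). By the reproducing property [(w | h) = c . h(X)] for all
    [h], so the first-order terms cancel when [E_alpha] is expanded around [w],
    and [E_alpha(v) >= E_alpha(w) + |v - w|^2 / 2] for every competitor [v]
    ([energy_gap]). Thus [w] is the unique minimizer, for [alpha = 0] as well as
    for [alpha > 0] ([minimizerE]).

    The monotonicity in [alpha] and the bounds by [u^0] then only compare the
    minimizers as competitors in each other's problems. The limit needs two expressions for the
    distance to [u^0]. The gap at the competitor [u^0] gives
    [|u^0 - u^alpha|^2 + |u^alpha(X) - Y|^2 / alpha <= |u^0|^2 - |u^alpha|^2],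
    while expanding [|u^alpha|^2] around [u^0 = \sum_k c_k K(. - x^k)], with
    [c = c_0], gives
    [|u^0 - u^alpha|^2 = |u^alpha|^2 - |u^0|^2 - 2 c . (u^alpha(X) - Y)].
    In the sum of the two the norms cancel, and completing a square bounds what
    remains: [2 |u^0 - u^alpha|^2 <= alpha |c|^2] ([minimizer_rate]), which is
    convergence with rate [sqrt alpha]. *)

(** * The Euclidean scalar product of row vectors *)

Section RowDot.
Context {R : realType} {n : nat}.
Implicit Types (a b c : 'rV[R]_n).

Definition row_dot a b : R := (a *m b^T) 0 0.

Lemma row_dotE a b : row_dot a b = \sum_k a 0 k * b 0 k.
Proof. by rewrite /row_dot mxE; apply: eq_bigr => k _; rewrite mxE. Qed.

Lemma row_dotC a b : row_dot a b = row_dot b a.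
Proof. by rewrite !row_dotE; apply: eq_bigr => k _; rewrite mulrC. Qed.

Lemma row_dotDr a b c : row_dot a (b + c) = row_dot a b + row_dot a c.
Proof. by rewrite /row_dot linearD /= mulmxDr mxE. Qed.

Lemma row_dotZr x a b : row_dot a (x *: b) = x * row_dot a b.
Proof. by rewrite /row_dot linearZ /= -scalemxAr mxE. Qed.

Lemma row_dotDl a b c : row_dot (a + b) c = row_dot a c + row_dot b c.
Proof. by rewrite row_dotC row_dotDr !(row_dotC c). Qed.

Lemma row_dotZl x a b : row_dot (x *: a) b = x * row_dot a b.
Proof. by rewrite row_dotC row_dotZr row_dotC. Qed.

Lemma row_dotvv_ge0 a : 0 <= row_dot a a.
Proof. by rewrite row_dotE; apply: sumr_ge0 => k _; rewrite -expr2 sqr_ge0. Qed.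

Lemma sqr_euclidean_norm a : euclidean_norm a ^+ 2 = row_dot a a.
Proof.
have aE : \sum_k a 0 k ^+ 2 = row_dot a a.
  by rewrite row_dotE; apply: eq_bigr => k _; rewrite expr2.
by rewrite /euclidean_norm aE sqr_sqrtr // row_dotvv_ge0.
Qed.

End RowDot.

(** * Kernel expansions in the native space *)

Section Ridge.
Context {R : realType} {d : nat} {K : 'rV[R]_d -> R}.
Context (H : native_space K) (n : nat) (X : 'I_n -> 'rV[R]_d).
Implicit Types (u v w : H) (c : 'rV[R]_n) (alpha : R).

Lemma sqr_normD u v :
  `|u + v| ^+ 2 = `|u| ^+ 2 + 2 * inner H u v + `|v| ^+ 2.
Proof.
have vuE : inner H v u = inner H u v by rewrite hermC expr0 mul1r.
by rewrite -!innerE linearDl /= !linearDr /= vuE; ring.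
Qed.

Lemma valuesD u v : values X (u + v) = values X u + values X v.
Proof.
apply/rowP => k; rewrite !mxE.
by have := eval_linear (n := H) 1 u v (X k); rewrite scale1r mul1r.
Qed.

Definition expansion c : H := \sum_k c 0 k *: translate H (X k).

Lemma inner_expansion c u : inner H (expansion c) u = row_dot c (values X u).
Proof.
rewrite linear_sumlz row_dotE; apply: eq_bigr => k _.
by rewrite linearZl_LR /= hermC expr0 mul1r /= reproducing mxE.
Qed.

Lemma values_expansion c : values X (expansion c) = c *m kernel_matrix K X.
Proof.
apply/rowP => j; rewrite !mxE -reproducing linear_sumlz; apply: eq_bigr => k _.
by rewrite linearZl_LR /= inner_translate mxE.
Qed.

Lemma sqr_norm_expansionD c u :
  `|expansion c + u| ^+ 2
    = `|expansion c| ^+ 2 + 2 * row_dot c (values X u) + `|u| ^+ 2.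
Proof. by rewrite sqr_normD inner_expansion. Qed.

(** * The minimizers *)

Hypotheses (K_pd : positive_definite_kernel K) (X_inj : injective X).
Variable (Y : 'rV[R]_n).

Lemma ridge_matrix_unit alpha :
  0 <= alpha -> kernel_matrix K X + alpha%:M \in unitmx.
Proof.
move=> alpha_ge0; rewrite -row_free_unit; apply: inj_row_free => c cA0.
apply/eqP; apply: contraT => c_neq0.
have [_ /(_ c c_neq0) cMc_gt0] := K_pd X_inj.
suff: row_dot (c *m (kernel_matrix K X + alpha%:M)) c > 0.
  by rewrite cA0 /row_dot mul0mx mxE ltxx.
rewrite mulmxDr mul_mx_scalar row_dotDl row_dotZl.
by rewrite ltr_wpDr // mulr_ge0 // row_dotvv_ge0.
Qed.

Definition ridge_coef alpha : 'rV[R]_n :=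
  Y *m invmx (kernel_matrix K X + alpha%:M).

(** This is the optimality condition of [E_alpha] for [alpha > 0] and the
    interpolation constraint for [alpha = 0]. *)
Lemma values_ridge alpha : 0 <= alpha ->
  values X (expansion (ridge_coef alpha)) = Y - alpha *: ridge_coef alpha.
Proof.
move=> alpha_ge0; apply/eqP; rewrite values_expansion eq_sym subr_eq.
by rewrite -mul_mx_scalar -mulmxDr mulmxKV // ridge_matrix_unit.
Qed.

Lemma sqr_misfit u : misfit X Y u ^+ 2 = row_dot (values X u - Y) (values X u - Y).
Proof. exact: sqr_euclidean_norm. Qed.

Lemma admissible_ridge alpha : 0 <= alpha ->
  admissible X Y alpha (expansion (ridge_coef alpha)).
Proof.
move=> alpha_ge0; rewrite /admissible; have [alpha0|//] := eqVneq alpha 0.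
by rewrite /= values_ridge // alpha0 scale0r subr0.
Qed.

(** Strong convexity at the critical point. With [h = v - w], the norm
    contributes the first-order term [2 c . h(X)] and the squared misfit over
    [alpha], by [values_ridge], its opposite; for [alpha = 0] the constraint
    forces [h(X) = 0]. The quadratic term of the norm is what remains. *)
Lemma energy_gap alpha v : 0 <= alpha -> admissible X Y alpha v ->
  energy X Y alpha (expansion (ridge_coef alpha))
    + 2^-1 * `|v - expansion (ridge_coef alpha)| ^+ 2 <= energy X Y alpha v.
Proof.
move=> alpha_ge0; set c := ridge_coef alpha; set w := expansion c.
rewrite -[v](subrK w) [v - w + w]addrC; move: (v - w) => h.
rewrite [w + h - w]addrC addKr /admissible /energy !sqr_norm_expansionD.
have wE := values_ridge alpha_ge0; rewrite -/c -/w in wE.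
have [alpha0|alpha_neq0] := eqVneq alpha 0.
  move=> /=; rewrite valuesD wE alpha0 scale0r subr0.
  rewrite -[RHS]addr0 => /addrI ->.
  by rewrite [row_dot c 0]row_dotE big1 => [|k _]; rewrite ?mxE ?mulr0 //; lra.
move=> _; rewrite !sqr_misfit valuesD wE.
have -> : Y - alpha *: c - Y = (- alpha) *: c by rewrite addrC addKr scaleNr.
have -> : Y - alpha *: c + values X h - Y = (- alpha) *: c + values X h.
  by rewrite addrAC [Y - _]addrC addrK scaleNr.
rewrite !row_dotDl !row_dotDr !row_dotZl !row_dotZr.
rewrite (row_dotC (values X h) c).
have : 0 <= alpha^-1 * row_dot (values X h) (values X h).
  by rewrite mulr_ge0 ?invr_ge0 // row_dotvv_ge0.
set p := row_dot c c; set q := row_dot c (values X h); set r := row_dot _ _.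
set N := `|w| ^+ 2; set L := `|h| ^+ 2 => r_ge0.
have -> : alpha^-1 * (- alpha * (- alpha * p) + - alpha * q + (- alpha * q + r))
    = alpha^-1 * (- alpha * (- alpha * p)) - 2 * q + alpha^-1 * r by field.
by lra.
Qed.

Lemma minimizerE alpha : 0 <= alpha ->
  minimizer H X Y alpha = expansion (ridge_coef alpha).
Proof.
move=> alpha_ge0; have w_adm := admissible_ridge alpha_ge0.
apply: xget_unique => [|v [v_adm v_min]].
  split=> // v /(energy_gap alpha_ge0); apply: le_trans.
  by rewrite lerDl mulr_ge0 ?invr_ge0 ?sqr_ge0.
have gap := energy_gap alpha_ge0 v_adm; have min := v_min _ w_adm.
apply/eqP; rewrite -subr_eq0 -normr_eq0 -sqrf_eq0 eq_le sqr_ge0 andbT.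
by lra.
Qed.

Lemma values_minimizer0 : values X (minimizer H X Y 0) = Y.
Proof. by rewrite minimizerE // values_ridge // scale0r subr0. Qed.

Lemma energy_minimizer_le alpha v : 0 < alpha ->
  energy X Y alpha (minimizer H X Y alpha)
    + 2^-1 * `|v - minimizer H X Y alpha| ^+ 2 <= energy X Y alpha v.
Proof.
move=> alpha_gt0; rewrite minimizerE ?(ltW alpha_gt0) //; apply: energy_gap.
  exact: ltW.
by rewrite /admissible (gt_eqF alpha_gt0).
Qed.

Lemma misfit_interpolant : misfit X Y (minimizer H X Y 0) ^+ 2 = 0.
Proof. by rewrite sqr_misfit values_minimizer0 subrr /row_dot mul0mx mxE. Qed.

(** The interpolant has no misfit, so its energy is half its squared norm for
    every [alpha]: this is the source of all bounds uniform in [alpha]. *)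
Lemma interpolant_gap alpha : 0 < alpha ->
  `|minimizer H X Y alpha| ^+ 2 + alpha^-1 * misfit X Y (minimizer H X Y alpha) ^+ 2
    + `|minimizer H X Y 0 - minimizer H X Y alpha| ^+ 2
  <= `|minimizer H X Y 0| ^+ 2.
Proof.
move=> alpha_gt0; have := energy_minimizer_le (minimizer H X Y 0) alpha_gt0.
by rewrite /energy (gt_eqF alpha_gt0) misfit_interpolant mulr0 addr0; lra.
Qed.

(** Only the coefficients of [u^0] enter the bound, so no control of the inverse
    of [M + alpha I] as [alpha] tends to [0] is needed. *)
Lemma minimizer_rate alpha : 0 < alpha ->
  2 * `|minimizer H X Y 0 - minimizer H X Y alpha| ^+ 2
    <= alpha * row_dot (ridge_coef 0) (ridge_coef 0).
Proof.
move=> alpha_gt0; have := interpolant_gap alpha_gt0.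
set u0 := minimizer H X Y 0; set u := minimizer H X Y alpha.
set c := ridge_coef 0; rewrite sqr_misfit; set m := values X u - Y.
have u0E : u0 = expansion c by rewrite /u0 minimizerE.
have mE : values X (u - u0) = m.
  apply/eqP; rewrite -(inj_eq (addIr Y)) subrK -{1}values_minimizer0.
  by rewrite -valuesD subrK.
clearbody m.
have := sqr_norm_expansionD c (u - u0).
rewrite -u0E mE addrC subrK (distrC u) => normE.
(* [|alpha c + m|^2 / alpha >= 0] absorbs the cross term [2 c . m]. *)
have := row_dotvv_ge0 (alpha *: c + m).
rewrite !row_dotDl !row_dotDr !row_dotZl !row_dotZr (row_dotC m c) => sq gap.
have : 0 <= alpha * row_dot c c + 2 * row_dot c m + alpha^-1 * row_dot m m.
  have -> : alpha * row_dot c c + 2 * row_dot c m + alpha^-1 * row_dot m m =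
     alpha^-1 * (alpha * (alpha * row_dot c c) + alpha * row_dot c m
       + (alpha * row_dot c m + row_dot m m)) by field; rewrite gt_eqF.
  by rewrite mulr_ge0 // invr_ge0 ltW.
by lra.
Qed.

Lemma minimizer_cvg0 :
  minimizer H X Y alpha @[alpha --> 0^'+] --> minimizer H X Y 0.
Proof.
pose C := row_dot (ridge_coef 0) (ridge_coef 0).
have C_ge0 : 0 <= C by exact: row_dotvv_ge0.
apply/cvgrPdist_le => e e_gt0; near=> alpha.
have alpha_gt0 : 0 < alpha by near: alpha; exact: nbhs_right_gt.
have alphaC : alpha * (C + 1) <= e ^+ 2.
  rewrite -ler_pdivlMr; last by rewrite ltr_wpDl.
  near: alpha; apply: nbhs_right_le.
  by rewrite divr_gt0 ?exprn_gt0 // ltr_wpDl.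
rewrite -(@ler_pXn2r _ 2) ?nnegrE ?(ltW e_gt0) //.
have := minimizer_rate alpha_gt0; rewrite -/C => rate.
have := sqr_ge0 `|minimizer H X Y 0 - minimizer H X Y alpha|.
move: alphaC; rewrite mulrDr mulr1; lra.
Unshelve. all: by end_near. Qed.

(** * Monotonicity and bounds in the regularization parameter *)

(** Testing each minimizer in the other's problem and adding,
    [(m0 - m1) (1/alpha0 - 1/alpha1) <= 0] for the squared misfits. *)
Lemma misfit_minimizer_mono alpha0 alpha1 : 0 < alpha0 -> alpha0 < alpha1 ->
  misfit X Y (minimizer H X Y alpha0) ^+ 2
    <= misfit X Y (minimizer H X Y alpha1) ^+ 2.
Proof.
move=> alpha0_gt0 alpha01; have alpha1_gt0 := lt_trans alpha0_gt0 alpha01.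
have := energy_minimizer_le (minimizer H X Y alpha1) alpha0_gt0.
have := energy_minimizer_le (minimizer H X Y alpha0) alpha1_gt0.
rewrite /energy !gt_eqF // distrC.
have := sqr_ge0 `|minimizer H X Y alpha1 - minimizer H X Y alpha0|.
set m0 := misfit X Y _ ^+ 2; set m1 := misfit X Y _ ^+ 2 => D_ge0 le1 le0.
have inv_lt : 0 < alpha0^-1 - alpha1^-1 by rewrite subr_gt0 ltf_pV2.
rewrite -subr_le0 -(pmulr_rle0 _ inv_lt).
by lra.
Qed.

Lemma norm_minimizer_mono alpha0 alpha1 : 0 < alpha0 -> alpha0 < alpha1 ->
  `|minimizer H X Y alpha1| <= `|minimizer H X Y alpha0|.
Proof.
move=> alpha0_gt0 alpha01; have alpha1_gt0 := lt_trans alpha0_gt0 alpha01.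
rewrite -(@ler_pXn2r _ 2) ?nnegrE //.
have := energy_minimizer_le (minimizer H X Y alpha0) alpha1_gt0.
rewrite /energy gt_eqF //.
have := sqr_ge0 `|minimizer H X Y alpha0 - minimizer H X Y alpha1|.
have := misfit_minimizer_mono alpha0_gt0 alpha01.
rewrite -(@ler_pM2l _ alpha1^-1) ?invr_gt0 //.
by lra.
Qed.

Lemma norm_minimizer_le0 alpha : 0 < alpha ->
  `|minimizer H X Y alpha| <= `|minimizer H X Y 0|.
Proof.
move=> alpha_gt0; rewrite -(@ler_pXn2r _ 2) ?nnegrE //.
apply: le_trans (interpolant_gap alpha_gt0).
rewrite -addrA lerDl addr_ge0 ?sqr_ge0 //.
by rewrite mulr_ge0 ?sqr_ge0 // invr_ge0 ltW.
Qed.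

Lemma misfit_minimizer_le alpha : 0 < alpha ->
  misfit X Y (minimizer H X Y alpha) ^+ 2
    <= alpha * (`|minimizer H X Y 0| ^+ 2 - `|minimizer H X Y alpha| ^+ 2).
Proof.
move=> alpha_gt0; rewrite mulrC -ler_pdivrMr // mulrC lerBrDl.
apply: le_trans (interpolant_gap alpha_gt0).
by rewrite lerDl sqr_ge0.
Qed.

Lemma min_energy_ge0 alpha : 0 < alpha -> 0 <= min_energy H X Y alpha.
Proof.
move=> alpha_gt0; rewrite /min_energy /energy gt_eqF //.
rewrite mulr_ge0 ?invr_ge0 // addr_ge0 ?sqr_ge0 //.
by rewrite mulr_ge0 ?sqr_ge0 // invr_ge0 ltW.
Qed.

Lemma min_energy_anti alpha0 alpha1 : 0 < alpha0 -> alpha0 < alpha1 ->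
  min_energy H X Y alpha1 <= min_energy H X Y alpha0.
Proof.
move=> alpha0_gt0 alpha01; have alpha1_gt0 := lt_trans alpha0_gt0 alpha01.
apply: (@le_trans _ _ (energy X Y alpha1 (minimizer H X Y alpha0))).
  apply: le_trans (energy_minimizer_le _ alpha1_gt0).
  by rewrite lerDl mulr_ge0 ?invr_ge0 ?sqr_ge0.
rewrite /min_energy /energy !gt_eqF // ler_wpM2l ?invr_ge0 // lerD2l.
by rewrite ler_wpM2r ?sqr_ge0 // lef_pV2 ?posrE // ltW.
Qed.

Lemma min_energy_le0 alpha : 0 < alpha ->
  min_energy H X Y alpha <= 2^-1 * `|minimizer H X Y 0| ^+ 2.
Proof.
move=> alpha_gt0; rewrite /min_energy /energy gt_eqF // ler_wpM2l ?invr_ge0 //.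
apply: le_trans (interpolant_gap alpha_gt0).
by rewrite lerDl sqr_ge0.
Qed.

End Ridge.

Theorem proposition2p8 (R : realType) (d : nat) (K : 'rV[R]_d -> R)
    (K_cont : continuous K) (K_pd : positive_definite_kernel K)
    (H : native_space K) (n : nat) (X : 'I_n -> 'rV[R]_d) (X_inj : injective X)
    (Y : 'rV[R]_n) :
  let u := minimizer H X Y in
  let e := min_energy H X Y in
  [/\ u alpha @[alpha --> 0^'+] --> u 0,
      forall alpha0 alpha1 : R, 0 < alpha0 -> alpha0 < alpha1 ->
        [/\ 0 <= e alpha1, e alpha1 <= e alpha0,
            e alpha0 <= 2^-1 * `|u 0| ^+ 2 &
            euclidean_norm (values X (u alpha0) - Y) ^+ 2
              <= euclidean_norm (values X (u alpha1) - Y) ^+ 2],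
      forall alpha0 alpha1 : R, 0 < alpha0 -> alpha0 < alpha1 ->
        `|u alpha1| <= `|u alpha0| /\ `|u alpha0| <= `|u 0| &
      forall alpha : R, 0 < alpha ->
        euclidean_norm (values X (u alpha) - Y) ^+ 2
          <= alpha * (`|u 0| ^+ 2 - `|u alpha| ^+ 2)].
Proof.
move=> u e; split.
- exact: minimizer_cvg0.
- move=> alpha0 alpha1 alpha0_gt0 alpha01; split.
  + by apply: min_energy_ge0; exact: lt_trans alpha01.
  + exact: min_energy_anti.
  + exact: min_energy_le0.
  + exact: misfit_minimizer_mono.
- move=> alpha0 alpha1 alpha0_gt0 alpha01.
  by split; [exact: norm_minimizer_mono | exact: norm_minimizer_le0].
- by move=> alpha; exact: misfit_minimizer_le.
Qed.
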